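(* Let $K=\mathbf{F}_q(t)$ be the rational function field over a finite field $\mathbf{F}_q$ of characteristic $p>0$, let $v$ be the valuation on $K$ corresponding to the place $t^{-1}$ (so the associated absolute value satisfies $|a|_v=q^{\deg a}$ for $a\in\mathbf{F}_q[t]$), and let $K_v$ be the completion of $K$ with respect to $v$. For a variety $V$ over $K$ and a point $P\in V(K_v)$, let $W(P)$ denote the intersection, over all $v$-adically open neighbourhoods $U$ of $P$ in $V(K_v)$, of the Zariski closures of $V(K)\cap U$. Then there exists a variety $V$ over $K$ such that the set $\{W(P) : P\in V(K_v)\}$ is infinite. *)

(* Defs.v *)
From HB Require Import structures.
From mathcomp Require Import all_boot all_order all_algebra.
From mathcomp Require Import fraction mxpoly.
From mathcomp Require Import mpoly.
From mathcomp Require Import boolp classical_sets functions cardinality reals.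

Set Implicit Arguments.
Unset Strict Implicit.
Unset Printing Implicit Defensive.

Import Order.TTheory GRing.Theory Num.Theory.
Local Open Scope classical_set_scope.
Local Open Scope ring_scope.

Notation ratfun F := {fraction {poly F}}.
Local Notation "x %:F" := (@FracField.tofrac _ x).

Section PlaceAtInfinity.
Variables (F : finFieldType) (R : realType).

(* The valuation of the place t^-1, meaningful for x != 0.  It is computed on
   the (not necessarily reduced) fraction chosen by repr; recall that
   (size p).-1 is the degree of p. *)
Definition val_inf (x : ratfun F) : int :=
  ((size (\d_(repr x) : {poly F})).-1)%:Z -
  ((size (\n_(repr x) : {poly F})).-1)%:Z.

Definition abs_inf (x : ratfun F) : R :=
  if x == 0 then 0 else (#|F|%:R : R) ^ (- val_inf x).

Lemma fracE (x : ratfun F) : x = (\n_(repr x))%:F / (\d_(repr x))%:F.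
Proof.
rewrite -{1}[x]reprK; move: (repr x) => y.
have d0 : (\d_y)%:F != 0 :> ratfun F by rewrite tofrac_eq0 denom_ratioP.
apply: (mulIf d0); rewrite divfK //; unlock FracField.tofrac.
rewrite -[LHS]FracField.pi_mul; apply/eqmodP => /=.
by rewrite FracField.equivfE /FracField.mulf /=
  !numden_Ratio ?(oner_neq0, mulr1, mulf_neq0, denom_ratioP) // mulrC.
Qed.

(* The choice of fraction does not matter. *)
Lemma abs_inf_div (a b : {poly F}) : a != 0 -> b != 0 ->
  abs_inf (a%:F / b%:F) =
    (#|F|%:R : R) ^ (((size a).-1)%:Z - ((size b).-1)%:Z).
Proof.
move=> a0 b0; rewrite /abs_inf /val_inf.
have b0' : b%:F != 0 :> ratfun F by rewrite tofrac_eq0.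
set x := a%:F / b%:F.
have x0 : x != 0 by rewrite mulf_neq0 ?invr_eq0 ?tofrac_eq0.
rewrite (negbTE x0) opprB; congr (_ ^ _).
have d0 : \d_(repr x) != 0 by rewrite denom_ratioP.
have d0' : (\d_(repr x))%:F != 0 :> ratfun F by rewrite tofrac_eq0.
have E : \n_(repr x) * b = a * \d_(repr x).
  apply/eqP; rewrite -tofrac_eq !tofracM -(eqr_div _ _ d0' b0').
  by rewrite -fracE.
have n0 : \n_(repr x) != 0.
  by apply: contra_neq (mulf_neq0 a0 d0) => n0; rewrite -E n0 mul0r.
move/(congr1 (fun p : {poly F} => size p)): E.
rewrite !size_mul //.
move: n0 b0 a0 d0; rewrite -!size_poly_gt0.
case: (size (\n_(repr x) : {poly F})) => // n; case: (size b) => // m.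
case: (size a) => // k; case: (size (\d_(repr x) : {poly F})) => // l _ _ _ _.
rewrite !addnS !addSn /= => -[E].
by apply/eqP; rewrite subr_eq addrAC eq_sym subr_eq -!PoszD E.
Qed.

Lemma abs_inf_poly (a : {poly F}) : a != 0 ->
  abs_inf a%:F = (#|F|%:R : R) ^+ (size a).-1.
Proof.
move=> a0; have := abs_inf_div a0 (oner_neq0 {poly F}).
by rewrite tofrac1 divr1 size_poly1 subr0.
Qed.

End PlaceAtInfinity.

Section Completion.
Variables (K Kv : fieldType) (R : realType).

Record is_absolute_value (L : fieldType) (abs : L -> R) : Prop := {
  abs_ge0 : forall x, 0 <= abs x ;
  abs_eq0 : forall x, abs x = 0 <-> x = 0 ;
  absM : forall x y, abs (x * y) = abs x * abs y ;
  abs_triangle : forall x y, abs (x + y) <= abs x + abs y }.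

Definition dense_image (j : K -> Kv) (abs : Kv -> R) : Prop :=
  forall (x : Kv) (e : R), 0 < e -> exists a : K, abs (x - j a) < e.

Definition complete_for (abs : Kv -> R) : Prop :=
  forall u : nat -> Kv,
    (forall e : R, 0 < e -> exists N : nat, forall m n : nat,
       (N <= m)%N -> (N <= n)%N -> abs (u m - u n) < e) ->
    exists l : Kv, forall e : R, 0 < e -> exists N : nat, forall n : nat,
       (N <= n)%N -> abs (u n - l) < e.

(* (Kv, absv) is, via j, a completion of (K, abs); this determines it up to a
   unique isometric isomorphism over K. *)
Record is_completion (abs : K -> R) (j : {rmorphism K -> Kv})
    (absv : Kv -> R) : Prop := {
  completion_abs : is_absolute_value absv ;
  completion_ext : forall a, absv (j a) = abs a ;
  completion_dense : dense_image j absv ;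
  completion_complete : complete_for absv }.

End Completion.

(* A closedFieldType is algebraically closed, so algebraicity over K is all
   that has to be required. *)
Definition is_alg_closure (K : fieldType) (Kbar : closedFieldType)
  (iota : {rmorphism K -> Kbar}) : Prop := integralRange iota.

Section Varieties.
Variable K : fieldType.

Definition homogeneous n (g : {mpoly K[n]}) : Prop :=
  exists d : nat, g \is d.-homog.

Definition eval_at (L : fieldType) (f : {rmorphism K -> L}) n
  (g : {mpoly K[n]}) (x : 'rV[L]_n) : L := mmap f (fun i => x 0 i) g.

(* A locally closed subscheme of projective n-space over K, given by the
   equations [g = 0 for all g in qp_eqs] and [g <> 0 for some g in qp_neqs];
   only the underlying reduced structure matters.  Affine varieties are the
   case qp_neqs = [:: 'X_0], projective ones the case qp_neqs = [:: 1]. *)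
Record quasiproj := Quasiproj {
  qp_dim : nat ;
  qp_eqs : seq {mpoly K[qp_dim.+1]} ;
  qp_neqs : seq {mpoly K[qp_dim.+1]} ;
  qp_eqs_homog : forall g, g \in qp_eqs -> homogeneous g ;
  qp_neqs_homog : forall g, g \in qp_neqs -> homogeneous g }.

(* Points of projective space are handled through their vectors of homogeneous
   coordinates: a subset of P^n(L) is represented by the set of all nonzero
   vectors that represent one of its points, a scaling-invariant set.  Thus
   two subsets of P^n(L) are equal iff the sets representing them are. *)
Definition points (X : quasiproj) (L : fieldType) (f : {rmorphism K -> L}) :
    set 'rV[L]_(qp_dim X).+1 :=
  [set x | [/\ x != 0,
     forall g, g \in qp_eqs X -> eval_at f g x = 0 &
     exists2 g, g \in qp_neqs X & eval_at f g x != 0]].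

Arguments points X {L} f.

Definition rat_points (X : quasiproj) : set 'rV[K]_(qp_dim X).+1 :=
  points X (idfun : {rmorphism K -> K}).

Arguments rat_points : clear implicits.

Section ZariskiTopology.
Variables (Kbar : closedFieldType) (iota : {rmorphism K -> Kbar}).

(* The topological space underlying the scheme X is described through the
   geometric points of X: its closed subsets correspond to the subsets of
   X(Kbar) cut out by homogeneous polynomials with coefficients in K. *)
Definition zariski_closed (X : quasiproj) (A : set 'rV[Kbar]_(qp_dim X).+1) :
    Prop :=
  exists2 T : set {mpoly K[(qp_dim X).+1]},
    (forall g, T g -> homogeneous g) &
    A = [set x | points X iota x /\ forall g, T g -> eval_at iota g x = 0].

Arguments zariski_closed : clear implicits.

Definition zariski_closure (X : quasiproj) (S : set 'rV[K]_(qp_dim X).+1) :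
    set 'rV[Kbar]_(qp_dim X).+1 :=
  \bigcap_(A in [set A | zariski_closed X A /\
                         [set map_mx iota x | x in S] `<=` A]) A.

Arguments zariski_closure : clear implicits.

Definition irreducible (X : quasiproj) : Prop :=
  points X iota !=set0 /\
  forall A B : set 'rV[Kbar]_(qp_dim X).+1,
    zariski_closed X A -> zariski_closed X B ->
    points X iota `<=` A `|` B ->
    points X iota `<=` A \/ points X iota `<=` B.

(* Taken with its reduced structure: an integral separated K-scheme of finite
   type. *)
Record variety := Variety {
  variety_qp :> quasiproj ;
  variety_irr : irreducible variety_qp }.

End ZariskiTopology.
Arguments zariski_closure {Kbar} iota X S.

Section AdicTopology.
Variables (R : realType) (Kv : fieldType) (j : {rmorphism K -> Kv}).
Variable absv : Kv -> R.

(* Open subsets of P^n(Kv) for the quotient topology from Kv^(n+1) \ {0}. *)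
Definition proj_open n (O : set 'rV[Kv]_n.+1) : Prop :=
  [/\ forall x, O x -> x != 0,
      forall (c : Kv) x, c != 0 -> O x -> O (c *: x) &
      forall x, O x -> exists2 e : R, 0 < e &
        forall y : 'rV[Kv]_n.+1, y != 0 ->
          (forall i, absv (y 0 i - x 0 i) < e) -> O y].

Definition adic_open (X : quasiproj) (U : set 'rV[Kv]_(qp_dim X).+1) : Prop :=
  exists2 O : set 'rV[Kv]_(qp_dim X).+1,
    proj_open O & U = points X j `&` O.

Arguments adic_open : clear implicits.

Variables (Kbar : closedFieldType) (iota : {rmorphism K -> Kbar}).

Definition W (X : quasiproj) (P : 'rV[Kv]_(qp_dim X).+1) :
    set 'rV[Kbar]_(qp_dim X).+1 :=
  \bigcap_(U in [set U | adic_open X U /\ U P])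
    zariski_closure iota X (rat_points X `&` [set x | U (map_mx j x)]).

End AdicTopology.
End Varieties.

Arguments points {K} X {L} f.
Arguments zariski_closed {K Kbar} iota X A.
Arguments zariski_closure {K Kbar} iota X S.
Arguments rat_points {K} X.
Arguments irreducible {K Kbar} iota X.
Arguments adic_open {K R Kv} j absv X U.
Arguments W {K R Kv} j absv {Kbar} iota X P.

(* Main.v *)
From HB Require Import structures.
Require Import Defs.
From mathcomp Require Import all_boot all_order all_algebra.
From mathcomp Require Import fraction mxpoly mpoly finfield.
From mathcomp Require Import boolp classical_sets functions cardinality reals.
From mathcomp Require Import ring lra zify.
Set Implicit Arguments.
Unset Strict Implicit.
Unset Printing Implicit Defensive.
Import Order.TTheory GRing.Theory Num.Theory.
Local Open Scope classical_set_scope.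
Local Open Scope ring_scope.

(** Let N = p^3 - 1 with p = char F.  If t X^N + (1 - t) Y^N = 1 with X, Y in
    K, a Wronskian (Mason-Stothers) argument shows that either X and Y are
    constant or (X, Y) = (t X1^(p^3), (1 - t) Y1^(p^3)) for another solution
    (X1, Y1), so by descent X is a polynomial.  Distinct polynomials are at
    v-adic distance at least 1, hence the values of X are v-adically isolated,
    although there are infinitely many of them: (t^e, (1-t)^e) with
    1 + e N = p^(3n) is a solution for every n.

    Instead of proving the Fermat curve irreducible, take a nonzero g in
    K[Y][X] of least X-degree vanishing at infinitely many of these solutions,
    and let V be the locus g = 0, lead_coef g <> 0.  By pseudo-division every
    polynomial that vanishes at infinitely many of these points of V vanishes
    on V: this makes V irreducible and a subset of the Fermat curve.  A small
    neighbourhood of such a rational point P contains only rational points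
    with the same X-coordinate, so W(P) lies in one fibre of X, and contains
    P.  Distinct P thus have distinct W(P). *)

(** * Derivatives, Wronskians and degree counts for polynomials *)

Lemma deriv_eq0_expr (F : finFieldType) (p : nat) (A : {poly F}) :
  p \in [pchar F] -> A^`() = 0 -> exists D, A = D ^+ p.
Proof.
move=> pF dA; have p_gt0 : (0 < p)%N := prime_gt0 (pcharf_prime pF).
have frobI : injective (pFrobenius_aut pF) := fmorph_inj _.
have pP : p \in [pchar {poly F}] by rewrite pchar_lalg.
(* As A' = 0, only exponents divisible by p occur in A. The coefficients have p-th roots because the
   Frobenius, injective on a finite field, is inverted by [invF]. *)
exists (\poly_(i < size A) invF frobI A`_(i * p)).
have -> : forall D : {poly F},
    D ^+ p = map_poly (pFrobenius_aut pF) D \Po 'X^p.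
  move=> D; rewrite -(pFrobenius_autE pP) -{1}[D]coefK poly_def rmorph_sum.
  rewrite comp_polyE size_map_poly; apply: eq_bigr => i _ /=.
  rewrite coef_map /= -!mul_polyC [pFrobenius_aut pP _]exprMn -!polyC_exp.
  by rewrite !pFrobenius_autE -!exprM mulnC.
apply/polyP => i; rewrite coef_comp_poly_Xn //.
have dvdE : (p %| i)%N = (i%:R == 0 :> F) by exact: dvdn_pcharf.
case: ifPn => [/dvdnP[k ->]|ndiv].
  rewrite mulnK // coef_map /= coef_poly; case: ltnP => [_|le_k].
    by rewrite f_invF.
  rewrite rmorph0 nth_default // (leq_trans le_k) //.
  by rewrite -{1}[k]muln1 leq_mul2l p_gt0 orbT.
case: i ndiv dvdE => [|i] ndiv dvdE; first by rewrite dvdn0 in ndiv.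
have /eqP := congr1 (fun q : {poly F} => q`_i) dA.
rewrite coef0 coef_deriv -mulr_natl mulf_eq0 -dvdE (negbTE ndiv) /=.
by move/eqP.
Qed.

Lemma deriv_div_eq0 (F : fieldType) (A : {poly F}) : A %| A^`() -> A^`() = 0.
Proof.
move=> dv; apply/eqP; apply: contraTT dv => nz; apply/negP => /(dvdp_leq nz).
rewrite leqNgt lt_size_deriv //; apply: contraNneq nz => ->.
by rewrite deriv0.
Qed.

Lemma wronskian_size (R : idomainType) (A B : {poly R}) :
  A * B^`() - B * A^`() != 0 ->
  ((size (A * B^`() - B * A^`())%R).-1 + 1 <= (size A).-1 + (size B).-1)%N.
Proof.
have H : forall A B : {poly R}, (size (A * B^`())%R <= (size A + size B).-2)%N.
  move=> {}A {}B; have [->|B0] := eqVneq B 0.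
    by rewrite deriv0 mulr0 size_poly0.
  apply: leq_trans (size_polyMleq _ _) _.
  by move: (lt_size_deriv B0); lia.
rewrite -size_poly_gt0 => nz.
have : (size (A * B^`() - B * A^`())%R <= (size A + size B).-2)%N.
  by rewrite (leq_trans (size_polyD _ _)) // size_polyN geq_max H addnC H.
lia.
Qed.

Lemma dvdp_exp_deg (F : fieldType) (A w : {poly F}) (M : nat) :
  w != 0 -> A ^+ M %| w -> ((size A).-1 * M <= (size w).-1)%N.
Proof.
by move=> w0 /(dvdp_leq w0) le; rewrite -size_exp -!subn1 leq_sub2r.
Qed.

(** Cramer's rule by elimination. Here a, b, c will carry the powers A^M, B^M, C^M, with u the
    Fermat equation and v its derivative; by coprimality each of these powers then divides the minor
    formed from the other two columns, up to powers of t. *)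
Lemma cramer2 (R : comPzRingType) (a b c u1 u2 u3 v1 v2 v3 : R) :
  a * u1 + b * u2 = c * u3 -> a * v1 + b * v2 = c * v3 ->
  a * (u1 * v2 - u2 * v1) = c * (u3 * v2 - u2 * v3) /\
  b * (u1 * v2 - u2 * v1) = c * (u1 * v3 - u3 * v1).
Proof.
move=> eu ev; split.
  by rewrite !mulrBr !mulrA -eu (mulrAC c) -ev; ring.
by rewrite !mulrBr !mulrA (mulrAC c) -ev -eu; ring.
Qed.

Lemma clear_denominators (K : fieldType) (t s a b c d : K) (N : nat) :
  b != 0 -> d != 0 -> t * (a / b) ^+ N + s * (c / d) ^+ N = 1 ->
  t * (a * d) ^+ N + s * (c * b) ^+ N = (b * d) ^+ N.
Proof.
move=> b0 d0 eqn; rewrite -[RHS]mulr1 -eqn !expr_div_n !exprMn.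
move: (expf_neq0 N b0) (expf_neq0 N d0).
move: (a ^+ N) (b ^+ N) (c ^+ N) (d ^+ N) => a' b' c' d' hb hd.
by field; rewrite hb hd.
Qed.

(** The Mason-Stothers count: a, b, c are the degrees of A, B, C, and x1, x2, x3 those of the minors
    that their m-th powers divide. Adding the bounds gives (m - 2)(a + b + c) + 3 <= m, which is
    absurd if c > 0. *)
Lemma degree_collapse (a b c m x1 x2 x3 : nat) :
  (3 < m)%N -> (c * m <= x3)%N -> (a * m <= x1)%N -> (b * m <= x2)%N ->
  (x1 + x2 + x3 + 3 <= 2 * (a + b + c) + m)%N -> c = 0%N.
Proof.
move=> m3 hc ha hb hs; apply/eqP; case: c hc hs => // c hc hs.
have : (a * 2 <= a * m)%N by rewrite leq_mul2l orbC; lia.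
have : (b * 2 <= b * m)%N by rewrite leq_mul2l orbC; lia.
have : (c * 2 <= c * m)%N by rewrite leq_mul2l orbC; lia.
rewrite mulSn in hc; move: (a * m)%N (b * m)%N (c * m)%N ha hb hc => *; lia.
Qed.

(** * Descent on the twisted Fermat equation over F[t] *)

Section FermatDescent.
Variables (F : finFieldType) (p : nat).
Hypothesis pF : p \in [pchar F].

Let t : {poly F} := 'X.
Let s : {poly F} := 1 - 'X.

Let p_gt1 : (1 < p)%N := prime_gt1 (pcharf_prime pF).
Let p_gt0 : (0 < p)%N := prime_gt0 (pcharf_prime pF).
Let pP : p \in [pchar {poly F}].
Proof. by rewrite pchar_lalg. Qed.

(* Taking p-th roots in the equation with i = 1 leads back to it through the
   exponents i = p^2 and i = p. *)
Definition twisted_fermat (i : nat) (A B C : {poly F}) : Prop :=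
  t ^+ i * A ^+ (p ^ 3).-1 + s ^+ i * B ^+ (p ^ 3).-1 = C ^+ (p ^ 3).-1.

Let M := (p ^ 3).-2.

Let p3E : (p ^ 3 = M.+2)%N.
Proof.
have : (1 < p ^ 3)%N by rewrite -(exp1n 3) ltn_exp2r.
by rewrite /M; case: (p ^ 3)%N => [|[]].
Qed.

(** The first bound absorbs the degree of the coefficient t^(p i) with p i <= p^2; the second is
    sharp at p = 2, where M = 6. *)
Let M_gt : (p ^ 2 < M)%N && (5 < M)%N.
Proof.
move: p3E p_gt1; clearbody M; case: (p) => [|[|q]] //.
by rewrite !expnS expn0 !muln1; nia. Qed.

Let s0 : s != 0.
Proof.
by rewrite -size_poly_gt0 /s -opprB size_polyN size_XsubC.
Qed.

Let size_s : size s = 2.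
Proof. by rewrite /s -opprB size_polyN size_XsubC. Qed.

(** The exponent p^3 - 1 is -1 in characteristic p. The differentiated Fermat equation is therefore
    again linear in A^M, B^M, C^M. *)
Let deriv_fermat_power (A : {poly F}) : (A ^+ M.+1)^`() = - (A ^+ M * A^`()).
Proof.
rewrite deriv_exp /= -mulr_natr.
have -> : M.+1%:R = -1 :> {poly F}.
  have : M.+2%:R = 0 :> {poly F} by rewrite -p3E natrX pcharf0 // expr0n.
  by rewrite -natr1 => /eqP; rewrite addr_eq0 => /eqP.
by rewrite mulrN1 mulrC.
Qed.

Let twistedE i A B C : twisted_fermat i A B C ->
  t ^+ i * A ^+ M * A + s ^+ i * B ^+ M * B = C ^+ M * C.
Proof. by rewrite /twisted_fermat p3E /= -!mulrA -!exprSr. Qed.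

(** The coefficients t^(p i) and s^(p i) have derivative 0, so the minors of [cramer2] are the
    Wronskians of A, B, C. If that of A and B were nonzero, the degree count would make C constant;
    hence all three vanish. *)
Lemma twisted_fermat_pth_power (i : nat) (A B C : {poly F}) :
  (p * i <= p ^ 2)%N -> (1 < size C)%N ->
  coprimep A B -> coprimep A C -> coprimep B C ->
  twisted_fermat (p * i) A B C ->
  exists A1 B1 C1, [/\ A = A1 ^+ p, B = B1 ^+ p & C = C1 ^+ p].
Proof.
move=> le_i C1 cAB cAC cBC eqn.
have C0 : C != 0 by rewrite -size_poly_gt0 ltnW.
have e1 := twistedE eqn.
have dpow : forall q : {poly F}, (q ^+ (p * i))^`() = 0.
  move=> q; rewrite deriv_exp -mulr_natr natrM (pcharf0 pP) mul0r mulr0 //.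
have e2 : t ^+ (p * i) * A ^+ M * A^`() + s ^+ (p * i) * B ^+ M * B^`()
    = C ^+ M * C^`().
  apply: oppr_inj; rewrite -deriv_fermat_power.
  have := congr1 (@deriv F) eqn; rewrite p3E /= => <-.
  rewrite derivD !derivM !dpow !deriv_fermat_power; ring.
have [f1 f2] := cramer2 e1 e2.
have w3 : A * B^`() - B * A^`() = 0.
  apply/eqP; apply: contraTT C1 => w3; rewrite -leqNgt.
  have A0 : A != 0.
    by apply: contraNneq w3 => ->; rewrite deriv0 mul0r mulr0 subrr.
  have B0 : B != 0.
    by apply: contraNneq w3 => ->; rewrite deriv0 mul0r mulr0 subrr.
  have w1 : C * B^`() - B * C^`() != 0.
    apply: contraTneq isT => w1; move/eqP: f1; rewrite w1 mulr0.
    by rewrite !mulf_eq0 !expf_eq0 (negbTE w3) (negbTE A0) polyX_eq0 !andbF.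
  have w2 : A * C^`() - C * A^`() != 0.
    apply: contraTneq isT => w2; move/eqP: f2; rewrite w2 mulr0.
    by rewrite !mulf_eq0 !expf_eq0 (negbTE w3) (negbTE B0) (negbTE s0) !andbF.
  have dA : A ^+ M %| C * B^`() - B * C^`().
    rewrite -(@Gauss_dvdpr _ _ (C ^+ M)) ?coprimep_expl ?coprimep_expr // -f1.
    by rewrite -mulrA dvdp_mull // dvdp_mulr.
  have dB : B ^+ M %| A * C^`() - C * A^`().
    rewrite -(@Gauss_dvdpr _ _ (C ^+ M)) ?coprimep_expl ?coprimep_expr // -f2.
    by rewrite -mulrA dvdp_mull // dvdp_mulr.
  have dC : C ^+ M %| t ^+ (p * i) * (A * B^`() - B * A^`()).
    rewrite -(@Gauss_dvdpr _ _ (A ^+ M)); last first.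
      by rewrite coprimep_expl ?coprimep_expr // coprimep_sym.
    by rewrite mulrCA mulrA f1 dvdp_mulr.
  have tw3 : t ^+ (p * i) * (A * B^`() - B * A^`()) != 0.
    by rewrite mulf_neq0 ?expf_neq0 ?polyX_eq0.
  have szt : (size (t ^+ (p * i) * (A * B^`() - B * A^`()))%R =
              p * i + size (A * B^`() - B * A^`())%R)%N.
    by rewrite size_mul // ?expf_neq0 ?polyX_eq0 // size_polyXn addSn.
  have szw3 : (0 < size (A * B^`() - B * A^`())%R)%N by rewrite size_poly_gt0.
  rewrite -subn_eq0 subn1; apply/eqP.
  have [kM m5] := andP M_gt.
  apply: (degree_collapse (ltnW (ltnW m5)) (dvdp_exp_deg tw3 dC)
    (dvdp_exp_deg w1 dA) (dvdp_exp_deg w2 dB)).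
  (* The factor [t ^+ (p * i)] raises the degree of the third minor by less than M, which is the
     slack [m] allowed by [degree_collapse]. *)
  rewrite szt; move: (leq_ltn_trans le_i kM) szw3 (wronskian_size w3).
  move: (wronskian_size w1) (wronskian_size w2).
  have arith k m a b c y1 y2 y3 : (y1 + 1 <= c + b)%N -> (y2 + 1 <= a + c)%N ->
      (k < m)%N -> (0 < y3)%N -> (y3.-1 + 1 <= a + b)%N ->
      (y1 + y2 + (k + y3).-1 + 3 <= 2 * (a + b + c) + m)%N by clear; lia.
  move=> h1 h2 hk h0 h3.
  exact: (arith _ _ _ _ _ _ _ _ h1 h2 hk h0 h3).
have Cw : forall w, 0 = C ^+ M * w -> w = 0.
  move=> w /esym/eqP; rewrite mulf_eq0 expf_eq0 (negbTE C0) andbF /=.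
  by move/eqP.
have /eqP w1 := Cw _ (etrans (esym (etrans (congr1 _ w3) (mulr0 _))) f1).
have /eqP w2 := Cw _ (etrans (esym (etrans (congr1 _ w3) (mulr0 _))) f2).
have /eqP {}w3 := w3.
rewrite !subr_eq0 in w1 w2 w3.
(* Vanishing Wronskians and coprimality make each polynomial divide its own derivative. *)
have dA : A^`() = 0.
  apply: deriv_div_eq0; rewrite -(@Gauss_dvdpr _ _ B) //.
  by rewrite -(eqP w3) dvdp_mulr.
have dB : B^`() = 0.
  apply: deriv_div_eq0; rewrite -(@Gauss_dvdpr _ _ A) 1?coprimep_sym //.
  by rewrite (eqP w3) dvdp_mulr.
have dC : C^`() = 0.
  apply: deriv_div_eq0; rewrite -(@Gauss_dvdpr _ _ B) 1?coprimep_sym //.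
  by rewrite -(eqP w1) dvdp_mulr.
have [A1 ->] := deriv_eq0_expr pF dA.
have [B1 ->] := deriv_eq0_expr pF dB.
have [C2 ->] := deriv_eq0_expr pF dC.
by exists A1, B1, C2.
Qed.

(** Now t and s have derivatives 1 and -1, so the rows for [cramer2] are (tA, sB, C) and (A - tA',
    -B - sB', -C'). The same degree count makes all minors vanish, but only C is then a p-th power:
    A and B retain the factors t and s. *)
Lemma twisted_fermat_ramified (A B C : {poly F}) :
  (1 < size C)%N -> coprimep A B -> coprimep A C -> coprimep B C ->
  twisted_fermat 1 A B C ->
  exists A1 B1 C1, [/\ A = t * A1 ^+ p, B = s * B1 ^+ p & C = C1 ^+ p].
Proof.
move=> C1 cAB cAC cBC eqn.
have C0 : C != 0 by rewrite -size_poly_gt0 ltnW.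
have ds : s^`() = -1 by rewrite derivB derivX derivC sub0r.
have e1 : A ^+ M * (t * A) + B ^+ M * (s * B) = C ^+ M * C.
  by rewrite -(twistedE eqn) !expr1; ring.
have e2 : A ^+ M * (A - t * A^`()) + B ^+ M * (- B - s * B^`())
    = C ^+ M * - C^`().
  rewrite mulrN -deriv_fermat_power.
  have := congr1 (@deriv F) eqn; rewrite p3E /= !expr1 => <-.
  rewrite derivD !derivM !deriv_fermat_power ds derivX !exprSr; ring.
have [] := cramer2 e1 e2.
set w3 := t * A * _ - _; set w1 := C * _ - _; set w2 := t * A * - _ - _.
move=> f1 f2.
have sz_mul (P1 P2 : {poly F}) m n k : (size P1 <= m.+1)%N ->
    (size P2 <= n.+1)%N -> (m + n)%N = k -> (size (P1 * P2)%R <= k.+1)%N.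
  by move=> h1 h2 <-; apply: leq_trans (size_polyMleq _ _) _; lia.
have sz_sub (P1 P2 : {poly F}) m :
    (size P1 <= m)%N -> (size P2 <= m)%N -> (size (P1 - P2)%R <= m)%N.
  move=> h1 h2; apply: leq_trans (size_polyD _ _) _.
  by rewrite size_polyN geq_max h1.
have sz_deriv (P : {poly F}) : (size P^`() <= (size P).-1)%N.
  have [->|P0] := eqVneq P 0; first by rewrite deriv0 size_poly0.
  by move: (lt_size_deriv P0); case: (size P).
have sz_lin (P : {poly F}) (L : {poly F}) :
    size L = 2 -> (size (L * P^`())%R <= (size P).-1.+1)%N.
  move=> L2; apply: leq_trans (size_polyMleq _ _) _; rewrite L2 addSn /=.
  by rewrite add1n ltnS.
have w30 : w3 = 0.
  apply/eqP/negPn/negP => w3n0.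
  suff : (size C <= 1)%N by rewrite leqNgt C1.
  have A0 : A != 0.
    apply: contraNneq w3n0 => A0.
    by rewrite /w3 A0 deriv0 !(mul0r, mulr0, subr0).
  have B0 : B != 0.
    apply: contraNneq w3n0 => B0.
    by rewrite /w3 B0 deriv0 !(mul0r, mulr0, subr0, oppr0).
  have w1n0 : w1 != 0.
    apply: contraNneq w3n0 => w10; move/eqP: f1; rewrite w10 mulr0.
    by rewrite mulf_eq0 expf_eq0 (negbTE A0) andbF.
  have w2n0 : w2 != 0.
    apply: contraNneq w3n0 => w20; move/eqP: f2; rewrite w20 mulr0.
    by rewrite mulf_eq0 expf_eq0 (negbTE B0) andbF.
  have dA : A ^+ M %| w1.
    rewrite -(@Gauss_dvdpr _ _ (C ^+ M)) ?coprimep_expl ?coprimep_expr // -f1.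
    by rewrite dvdp_mulr.
  have dB : B ^+ M %| w2.
    rewrite -(@Gauss_dvdpr _ _ (C ^+ M)) ?coprimep_expl ?coprimep_expr // -f2.
    by rewrite dvdp_mulr.
  have dC : C ^+ M %| w3.
    rewrite -(@Gauss_dvdpr _ _ (A ^+ M)); last first.
      by rewrite coprimep_expl ?coprimep_expr // coprimep_sym.
    by rewrite f1 dvdp_mulr.
  have szA : size A = (size A).-1.+1 by rewrite prednK ?size_poly_gt0.
  have szB : size B = (size B).-1.+1 by rewrite prednK ?size_poly_gt0.
  have szC : size C = (size C).-1.+1 by rewrite prednK ?size_poly_gt0.
  have sztA : (size (t * A)%R <= (size A).-1.+2)%N.
    by rewrite mulrC size_mulX // {1}szA.
  have szsB : (size (s * B)%R <= (size B).-1.+2)%N.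
    by apply: leq_trans (size_polyMleq _ _) _; rewrite size_s szB.
  have szv1 : (size (A - t * A^`())%R <= (size A).-1.+1)%N.
    by rewrite sz_sub ?sz_lin ?size_polyX -?szA.
  have szv2 : (size (- B - s * B^`())%R <= (size B).-1.+1)%N.
    by rewrite sz_sub ?sz_lin // size_polyN -szB.
  have szv3 : (size (- C^`())%R <= (size C).-2.+1)%N.
    by rewrite size_polyN; apply: leq_trans (sz_deriv C) _; case: (size C).-1.
  (* As C is nonconstant, differentiating it saves one degree, which offsets the extra factor t or s
     in the minors [w1] and [w2]. *)
  have c_gt0 : (size C).-2.+1 = (size C).-1 by case: (size C) C1 => [|[]].
  have szC1 : (size C <= (size C).-1.+1)%N by rewrite -szC.
  have szw3 : (size w3 <= ((size A).-1.+1 + (size B).-1).+1)%N.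
    apply: sz_sub; first exact: (sz_mul _ _ _ _ _ sztA szv2 (erefl _)).
    by apply: (sz_mul _ _ _ _ _ szsB szv1); rewrite addSnnS addnC.
  have szw1 : (size w1 <= ((size B).-1 + (size C).-1).+1)%N.
    apply: sz_sub; first by apply: (sz_mul _ _ _ _ _ szC1 szv2); rewrite addnC.
    by apply: (sz_mul _ _ _ _ _ szsB szv3); rewrite -[in RHS]c_gt0 addSnnS.
  have szw2 : (size w2 <= ((size A).-1 + (size C).-1).+1)%N.
    apply: sz_sub; last by apply: (sz_mul _ _ _ _ _ szC1 szv1); rewrite addnC.
    by apply: (sz_mul _ _ _ _ _ sztA szv3); rewrite -[in RHS]c_gt0 addSnnS.
  rewrite -subn_eq0 subn1; apply/eqP.
  have [_ m5] := andP M_gt.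
  apply: (degree_collapse (ltnW (ltnW m5)) (dvdp_exp_deg w3n0 dC)
    (dvdp_exp_deg w1n0 dA) (dvdp_exp_deg w2n0 dB)).
  have arith m a b c z1 z2 z3 : (5 < m)%N -> (z3 <= (a.+1 + b).+1)%N ->
      (z1 <= (b + c).+1)%N -> (z2 <= (a + c).+1)%N ->
      (z1.-1 + z2.-1 + z3.-1 + 3 <= 2 * (a + b + c) + m)%N by clear; lia.
  exact: (arith _ _ _ _ _ _ _ m5 szw3 szw1 szw2).
have Cw w : 0 = C ^+ M * w -> w = 0.
  by move/esym/eqP; rewrite mulf_eq0 expf_eq0 (negbTE C0) andbF => /eqP.
have w10 : w1 = 0 by apply: Cw; rewrite -f1 w30 mulr0.
have w20 : w2 = 0 by apply: Cw; rewrite -f2 w30 mulr0.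
(* The minors give C | tC' and C | sC', and t + s = 1. *)
have dC : C^`() = 0.
  apply: deriv_div_eq0.
  have Ct : C %| t * C^`().
    rewrite -(@Gauss_dvdpr _ _ A) 1?coprimep_sym //.
    have -> : A * (t * C^`()) = - w2 - C * (A - t * A^`()) by rewrite /w2; ring.
    by rewrite w20 oppr0 sub0r dvdpNr dvdp_mulr.
  have Cs : C %| s * C^`().
    rewrite -(@Gauss_dvdpr _ _ B) 1?coprimep_sym //.
    have -> : B * (s * C^`()) = w1 - C * (- B - s * B^`()) by rewrite /w1; ring.
    by rewrite w10 sub0r dvdpNr dvdp_mulr.
  have -> : C^`() = t * C^`() + s * C^`() by rewrite /s /t; ring.
  exact: dvdp_add.
have factor w : 0 = C * w -> w = 0.
  by move/esym/eqP; rewrite mulf_eq0 (negbTE C0) => /eqP.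
(* With C' = 0 the minors reduce to A = tA' and B = -sB'. Differentiating these gives A'' = B'' = 0,
   so A' and -B' are p-th powers. *)
have eA : A = t * A^`().
  apply/eqP; rewrite -subr_eq0; apply/eqP/factor.
  by rewrite -[0]oppr0 -w20 /w2 dC; ring.
have eB : B = s * - B^`().
  apply/eqP; rewrite -subr_eq0; apply/eqP/oppr_inj; rewrite oppr0.
  apply: factor.
  by rewrite -w10 /w1 dC; ring.
have d2A : A^`()^`() = 0.
  have /eqP := congr1 (@deriv F) eA; rewrite derivM derivX mul1r eq_sym.
  rewrite -subr_eq0 addrAC subrr add0r mulf_eq0 polyX_eq0 => /eqP //.
have d2B : (- B^`())^`() = 0.
  have /eqP := congr1 (@deriv F) eB; rewrite derivM ds mulN1r opprK eq_sym.
  by rewrite -subr_eq0 addrAC subrr add0r mulf_eq0 (negbTE s0) => /eqP.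
have [A1 hA1] := deriv_eq0_expr pF d2A.
have [B1 hB1] := deriv_eq0_expr pF d2B.
have [C2 hC2] := deriv_eq0_expr pF dC.
by exists A1, B1, C2; rewrite -hA1 -hB1.
Qed.

(** Both sides are p-th powers, and the Frobenius of F[t] is additive and injective. *)
Lemma twisted_fermat_frobenius (i : nat) (A B C : {poly F}) :
  twisted_fermat (p * i) (A ^+ p) (B ^+ p) (C ^+ p) -> twisted_fermat i A B C.
Proof.
rewrite /twisted_fermat -!exprM ![(p * _)%N]mulnC !exprM -!exprMn.
rewrite -!(pFrobenius_autE pP) -rmorphD /= => /eqP.
rewrite -subr_eq0 -rmorphB /= pFrobenius_autE expf_eq0 p_gt0 subr_eq0 /=.
by move/eqP.
Qed.

(** Infinite descent: as long as C is nonconstant, a p-th root can be extracted, which divides deg C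
    by p and moves r through 0, 2, 1, 0. *)
Lemma twisted_fermat_denominator (r : nat) (A B C : {poly F}) :
  (r <= 2)%N -> coprimep A B -> coprimep A C -> coprimep B C ->
  twisted_fermat (p ^ r) A B C -> (size C <= 1)%N.
Proof.
have [n le_n] := ubnP (size C); elim: n => // n IHn in r A B C le_n *.
move=> r2 cAB cAC cBC eqn; have [//|C1] := leqP (size C) 1.
have size_root (H : {poly F}) : C = H ^+ p -> (size H < n)%N /\ (1 < size H)%N.
  move=> eC; move: (size_exp H p) C1 le_n; rewrite -eC.
  case: (size C) => // c; case: (size H) => [|h] /=.
    by rewrite mul0n; lia.
  by move=> ->; move: p_gt1; case: (p) => [|[|q]] // _; rewrite mulnS; nia.
have root_coprime (P1 P2 : {poly F}) :
    coprimep (P1 ^+ p) (P2 ^+ p) = coprimep P1 P2.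
  by rewrite coprimep_pexpl // coprimep_pexpr.
suff [r' [A1 [B1 [C1' [r'2 eC [c1 c2 c3] eqn']]]]] : exists r' A1 B1 C1,
    [/\ (r' <= 2)%N, C = C1 ^+ p,
        [/\ coprimep A1 B1, coprimep A1 C1 & coprimep B1 C1]
      & twisted_fermat (p ^ r') A1 B1 C1].
  have [ltH gtH] := size_root _ eC.
  by move: (IHn _ _ _ _ ltH r'2 c1 c2 c3 eqn'); rewrite leqNgt gtH.
case: r r2 eqn => [|r] r2 eqn.
  have [A1 [B1 [H [eA eB eC]]]] := twisted_fermat_ramified C1 cAB cAC cBC eqn.
  have dA : A1 ^+ p %| A by rewrite eA dvdp_mull.
  have dB : B1 ^+ p %| B by rewrite eB dvdp_mull.
  (* With A = t A1^p the first term becomes t^(p^3) A1^(p N), the p-th power of t^(p^2) A1^N;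
     likewise for s and B. Hence the new exponent r' = 2. *)
  exists 2, A1, B1, H; split => //.
    split; rewrite -root_coprime -?eC.
    - exact: coprimep_dvdr dA (coprimep_dvdl dB cAB).
    - exact: coprimep_dvdr dA cAC.
    - exact: coprimep_dvdr dB cBC.
  apply: twisted_fermat_frobenius; rewrite -expnS.
  move: eqn; rewrite /twisted_fermat eA eB eC !expr1 !exprMn !mulrA -!exprS.
  by rewrite prednK // expn_gt0 p_gt0.
rewrite expnS in eqn; have le2 : (p * p ^ r <= p ^ 2)%N.
  by rewrite -expnS leq_pexp2l.
have [A1 [B1 [H [eA eB eC]]]] :=
  twisted_fermat_pth_power le2 C1 cAB cAC cBC eqn.
exists r, A1, B1, H; split; rewrite ?(ltnW r2) //.
  split.
  - by rewrite -root_coprime -eA -eB.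
  - by rewrite -root_coprime -eA -eC.
  - by rewrite -root_coprime -eB -eC.
by apply: twisted_fermat_frobenius; rewrite -eA -eB -eC.
Qed.

(** The N-th power of the gcd of two of the polynomials divides the remaining term, hence its
    coefficient 1, s or t. That coefficient has degree at most 1 and N >= 2, so the gcd is
    constant. *)
Lemma twisted_fermat_coprime (A B C : {poly F}) :
  C != 0 -> coprimep (gcdp A B) C -> twisted_fermat 1 A B C ->
  [/\ coprimep A B, coprimep A C & coprimep B C].
Proof.
rewrite /twisted_fermat !expr1; set N := (_).-1 => C0 cABC eqn.
have N2 : (1 < N)%N by move: M_gt; rewrite /N p3E /= => /andP[_]; lia.
have unit_of (D L : {poly F}) : L != 0 -> (size L <= 2)%N -> D ^+ N %| L ->
    (size D <= 1)%N.
  move=> L0 L2 /(dvdp_exp_deg L0); move: N2 L2.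
  by case: (size D) (size L) => [|[|d]] // l; rewrite mulSn; nia.
have coprime_of (P1 P2 : {poly F}) : (P1 != 0) || (P2 != 0) ->
    (size (gcdp P1 P2) <= 1)%N -> coprimep P1 P2.
  move=> P0; rewrite /coprimep eqn_leq => -> /=; rewrite size_poly_gt0.
  by rewrite gcdp_eq0 negb_and.
have unit3 (E : {poly F}) : E %| A -> E %| B -> E %| C -> E %= 1.
  by move=> EA EB; apply/(coprimepP _ _ cABC); rewrite dvdp_gcd EA.
have N0 : (0 < N)%N := ltnW N2.
split.
- apply: coprime_of.
    rewrite -negb_and; apply: contra_neqN C0 => /andP[/eqP A0 /eqP B0].
    move: eqn; rewrite A0 B0 expr0n (gtn_eqF N0) !mulr0 addr0.
    by move/esym/eqP; rewrite expf_eq0 => /andP[_ /eqP].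
  apply: (unit_of _ 1); rewrite ?oner_eq0 ?size_poly1 //.
  rewrite -(@Gauss_dvdpr _ _ (C ^+ N)); last first.
    by rewrite coprimep_expl ?coprimep_expr.
  rewrite mulr1 -eqn.
  by rewrite dvdp_add // dvdp_mull // dvdp_exp2r ?dvdp_gcdl ?dvdp_gcdr.
- apply: coprime_of; first by rewrite C0 orbT.
  apply: (unit_of _ s); rewrite ?size_s //.
  rewrite -(@Gauss_dvdpl _ _ (B ^+ N)); last first.
    rewrite coprimep_expl ?coprimep_expr //; apply/coprimepP => E EAC EB.
    apply: unit3 => //; apply: dvdp_trans EAC _;
      by rewrite ?dvdp_gcdl ?dvdp_gcdr.
  have -> : s * B ^+ N = C ^+ N - t * A ^+ N by rewrite -eqn; ring.
  by rewrite dvdp_add ?dvdpNr // ?dvdp_mull // dvdp_exp2r ?dvdp_gcdl ?dvdp_gcdr.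
apply: coprime_of; first by rewrite C0 orbT.
apply: (unit_of _ t); rewrite ?polyX_eq0 ?size_polyX //.
rewrite -(@Gauss_dvdpl _ _ (A ^+ N)); last first.
  rewrite coprimep_expl ?coprimep_expr //; apply/coprimepP => E EBC EA.
  by apply: unit3 => //; apply: dvdp_trans EBC _; rewrite ?dvdp_gcdl ?dvdp_gcdr.
have -> : t * A ^+ N = C ^+ N - s * B ^+ N by rewrite -eqn; ring.
by rewrite dvdp_add ?dvdpNr // ?dvdp_mull // dvdp_exp2r ?dvdp_gcdl ?dvdp_gcdr.
Qed.

Local Notation "x %:F" := (@FracField.tofrac {poly F} x).

(** Over the common denominator [b * d], and after division by the gcd of all three terms, the
    descent shows that the denominator is constant. *)
Lemma fermat_point_integral (X Y : ratfun F) :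
  t%:F * X ^+ (p ^ 3).-1 + s%:F * Y ^+ (p ^ 3).-1 = 1 -> exists a, X = a%:F.
Proof.
set N := (_).-1; rewrite (fracE X) (fracE Y).
have := denom_ratioP (repr X); have := denom_ratioP (repr Y).
move: (\n_(repr X)) (\d_(repr X)) (\n_(repr Y)) (\d_(repr Y)).
move=> a b c d d0 b0 eqn.
have b0' : b%:F != 0 by rewrite tofrac_eq0.
have d0' : d%:F != 0 by rewrite tofrac_eq0.
pose A0 := a * d; pose B0 := c * b; pose C0 := b * d.
have C0n0 : C0 != 0 by rewrite mulf_neq0.
have eqn0 : t * A0 ^+ N + s * B0 ^+ N = C0 ^+ N.
  have := clear_denominators b0' d0' eqn.
  rewrite -!tofracM -!tofracXn -!tofracM -tofracD => /eqP.
  by rewrite tofrac_eq => /eqP.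
pose G := gcdp (gcdp A0 B0) C0.
have G0 : G != 0 by rewrite gcdp_eq0 negb_and C0n0 orbT.
have GA : A0 = (A0 %/ G) * G.
  by rewrite divpK // (dvdp_trans (dvdp_gcdl _ _)) ?dvdp_gcdl.
have GB : B0 = (B0 %/ G) * G.
  by rewrite divpK // (dvdp_trans (dvdp_gcdl _ _)) ?dvdp_gcdr.
have GC : C0 = (C0 %/ G) * G by rewrite divpK // dvdp_gcdr.
set A := A0 %/ G in GA; set B := B0 %/ G in GB; set C := C0 %/ G in GC.
have Cn0 : C != 0 by apply: contraNneq C0n0 => C00; rewrite GC C00 mul0r.
have eqn1 : twisted_fermat 1 A B C.
  rewrite /twisted_fermat !expr1; apply: (mulIf (expf_neq0 N G0)).
  by rewrite mulrDl -!mulrA -!exprMn -GA -GB -GC.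
have cop : coprimep (gcdp A B) C.
  have := @coprimep_div_gcd _ (gcdp A0 B0) C0.
  rewrite C0n0 orbT => /(_ isT); apply: coprimep_dvdr.
  rewrite -(dvdp_mul2r _ _ G0) divpK ?dvdp_gcdl // dvdp_gcd GA GB.
  by rewrite !dvdp_mul2r // dvdp_gcdl dvdp_gcdr.
have hA : a * d = A * G := GA; have hC : b * d = C * G := GC.
clear GA GB GC eqn0; clearbody A B C G.
have [cAB cAC cBC] := twisted_fermat_coprime Cn0 cop eqn1.
have /size1_polyC eC :=
  twisted_fermat_denominator (r := 0) isT cAB cAC cBC eqn1.
have c0 : C`_0 != 0 by move: Cn0; rewrite {1}eC polyC_eq0.
exists ((C`_0)^-1 *: A).
have eN : a * C = A * b.
  apply: (mulIf (mulf_neq0 d0 G0)); rewrite mulrACA hA -hC.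
  by rewrite (mulrC b) (mulrC d) mulrACA (mulrC G).
suff eab : a = (C`_0)^-1 *: A * b by rewrite {1}eab tofracM (mulfK b0').
apply: (mulIf Cn0); rewrite eN {2}eC [RHS]mulrC mul_polyC -scalerAl scalerA.
by rewrite mulfV ?scale1r.
Qed.
End FermatDescent.

(** * Bivariate polynomials and their zeros along a sequence of points *)

(* The outer variable of [{poly {poly K}}] is X, the inner one is Y. *)
Definition bieval (K L : fieldType) (phi : {rmorphism K -> L}) (a b : L) :
    {poly {poly K}} -> L :=
  horner_eval b \o (horner_eval a%:P \o map_poly (map_poly phi)).

HB.instance Definition _ (K L : fieldType) (phi : {rmorphism K -> L})
    (a b : L) :=
  GRing.RMorphism.copy (bieval phi a b)
    (horner_eval b \o (horner_eval a%:P \o map_poly (map_poly phi))).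

Lemma bievalX (K L : fieldType) (phi : {rmorphism K -> L}) (a b : L) :
  bieval phi a b 'X = a.
Proof. by rewrite /bieval /= map_polyX /horner_eval hornerX hornerC. Qed.

Lemma bievalC (K L : fieldType) (phi : {rmorphism K -> L}) (a b : L)
    (c : {poly K}) :
  bieval phi a b c%:P = (map_poly phi c).[b].
Proof. by rewrite /bieval /= map_polyC /horner_eval hornerC. Qed.

Lemma bievalE (K L : fieldType) (phi : {rmorphism K -> L}) (a b : L)
    (g : {poly {poly K}}) :
  bieval phi a b g =
    \sum_(i < size g) \sum_(k < size g`_i) phi g`_i`_k * b ^+ k * a ^+ i.
Proof.
rewrite -{1}[g]coefK poly_def rmorph_sum /=; apply: eq_bigr => i _.
rewrite -mul_polyC rmorphM rmorphXn /= bievalX bievalC horner_coef.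
rewrite size_map_poly mulr_suml; apply: eq_bigr => k _.
by rewrite coef_map.
Qed.

Lemma poly_infinitely_many_roots (K : fieldType) (y : nat -> K) (h : {poly K}) :
  injective y -> (forall m, exists2 n, (m <= n)%N & h.[y n] = 0) -> h = 0.
Proof.
move=> y_inj hy; apply/eqP/negPn/negP => h0.
suff [ns [uns sz ans]] : exists ns : seq nat, [/\ uniq ns, size ns = size h
    & all (root h) (map y ns)].
  have := max_poly_roots h0 ans; rewrite map_inj_uniq // => /(_ uns).
  by rewrite size_map sz ltnn.
move: (size h) => k; elim: k => [|k [ns [uns sz ans]]]; first by exists [::].
have [n len hn] := hy (\max_(i <- ns) i).+1.
exists (n :: ns); rewrite /= sz uns ans andbT /root hn eqxx; split=> //.
by apply: contraL len => nin; rewrite -leqNgt (leq_bigmax_seq (F := id)).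
Qed.

Section MinimalEquation.
Variables (K : fieldType) (x y : nat -> K).
Hypothesis y_inj : injective y.

(** Infinitude is expressed as unboundedness of the indices; [common_zeros g g] says that g alone
    vanishes at infinitely many of the points. *)
Definition common_zeros (f g : {poly {poly K}}) : Prop :=
  forall m, exists n, [/\ (m <= n)%N, bieval idfun (x n) (y n) f = 0 &
                          bieval idfun (x n) (y n) g = 0].

(** Take g of least size in X. The pseudo-remainder of f by g vanishes wherever f and g both do, and
    is smaller than g, so minimality forces it to be 0. *)
Lemma minimal_equation (g0 : {poly {poly K}}) :
  g0 != 0 -> (forall n, bieval idfun (x n) (y n) g0 = 0) ->
  exists g : {poly {poly K}}, [/\ g != 0, common_zeros g g &
    forall f, common_zeros f g ->
      exists k q, (lead_coef g) ^+ k *: f = q * g].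
Proof.
move=> g00 zero_g0.
pose P k := `[< exists g, [/\ g != 0, common_zeros g g & size g = k] >].
have exP : exists k, P k.
  exists (size g0); apply/asboolP; exists g0; split=> // m.
  by exists m; rewrite zero_g0.
case: (ex_minnP exP) => k /asboolP[g [gn0 zg eg]] kmin.
exists g; split => // f zf.
exists (Pdiv.Idomain.scalp f g), (f %/ g); rewrite Pdiv.Idomain.divp_eq.
suff -> : f %% g = 0 by rewrite addr0.
apply/eqP/negPn/negP => r0.
have : (k <= size (f %% g)%R)%N.
  apply: kmin; apply/asboolP; exists (f %% g); split=> // m.
  have [n [le_n zfn zgn]] := zf m; exists n; rewrite le_n.
  have := congr1 (bieval idfun (x n) (y n)) (Pdiv.Idomain.divp_eq f g).
  rewrite rmorphD rmorphM /= zgn mulr0 add0r -mul_polyC rmorphM /= zfn mulr0.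
  by move=> <-.
by rewrite leqNgt -eg ltn_modp gn0.
Qed.

Lemma eventually_nonzero (h : {poly K}) :
  h != 0 -> exists m, forall n, (m <= n)%N -> h.[y n] != 0.
Proof.
move=> h0; apply: contrapT => nex; move/eqP: h0; apply.
apply: (poly_infinitely_many_roots y_inj) => m; apply: contrapT => nex'.
apply: nex; exists m => n le_n; apply/eqP => hn; apply: nex'; by exists n.
Qed.

End MinimalEquation.

(** * Passage between affine and homogeneous equations in the plane *)

Local Notation i0 := (ord0 : 'I_3).
Local Notation i1 := (lift ord0 ord0 : 'I_3).
Local Notation i2 := (lift ord0 (lift ord0 ord0) : 'I_3).

Lemma eval_at_map (K L : fieldType) (phi : {rmorphism K -> L}) (n : nat)
    (g : {mpoly K[n]}) (v : 'rV[K]_n) :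
  eval_at phi g (map_mx phi v) = phi (eval_at idfun g v).
Proof.
rewrite /eval_at /mmap rmorph_sum /=; apply: eq_bigr => m _.
rewrite rmorphM /= /mmap1 rmorph_prod; congr (_ * _).
by apply: eq_bigr => i _; rewrite rmorphXn mxE.
Qed.

(** A single form G serves all extensions of K at once, since points over K, [Kv] and [Kbar] have to
    be compared. *)
Lemma homogenize (K : fieldType) (g : {poly {poly K}}) :
  exists d (G : {mpoly K[3]}), G \is d.-homog /\
    forall (L : fieldType) (phi : {rmorphism K -> L}) (v : 'rV[L]_3),
      v 0 i2 != 0 -> eval_at phi G v =
        v 0 i2 ^+ d * bieval phi (v 0 i0 / v 0 i2) (v 0 i1 / v 0 i2) g.
Proof.
(* Any upper bound for the total degree will do; this one is read off the sizes. *)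
pose d := (size g + \max_(i < size g) size (g`_i)%R)%N.
have le_d (i : 'I_(size g)) (k : 'I_(size g`_i)) : (i + k <= d)%N.
  apply: leq_add; first exact: ltnW.
  by apply: leq_trans (ltnW (ltn_ord k)) _; apply: (leq_bigmax i).
exists d, (\sum_(i < size g) \sum_(k < size g`_i)
  g`_i`_k *: ('X_i0 ^+ i * 'X_i1 ^+ k * 'X_i2 ^+ (d - (i + k)))); split.
  apply: rpred_sum => i _; apply: rpred_sum => k _; apply: dhomogZ.
  have X1 (i' : 'I_3) : ('X_i' : {mpoly K[3]}) \is 1.-homog.
    by rewrite dhomogX /= mdeg1.
  have := dhomogM (dhomogM (dhomogMn i (X1 i0)) (dhomogMn k (X1 i1)))
    (dhomogMn (d - (i + k)) (X1 i2)).
  by rewrite !mul1n subnKC.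
move=> L phi v v0; rewrite /eval_at rmorph_sum /= bievalE mulr_sumr.
apply: eq_bigr => i _; rewrite rmorph_sum /= mulr_sumr; apply: eq_bigr => k _.
rewrite mmapZ !rmorphM !rmorphXn /= !mmapX !mmap1U /=.
have -> : v 0 i2 ^+ d = v 0 i2 ^+ (i + k + (d - (i + k))) by rewrite subnKC.
rewrite !exprD !exprMn !exprVn.
move: (expf_neq0 i v0) (expf_neq0 k v0).
move: (v 0 i2 ^+ i) (v 0 i2 ^+ k) => a b a0 b0.
by field; rewrite a0 b0.
Qed.

Lemma dehomogenize (K : fieldType) (d : nat) (f : {mpoly K[3]}) :
  f \is d.-homog -> exists h : {poly {poly K}},
    forall (L : fieldType) (phi : {rmorphism K -> L}) (v : 'rV[L]_3),
      v 0 i2 != 0 -> eval_at phi f v =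
        v 0 i2 ^+ d * bieval phi (v 0 i0 / v 0 i2) (v 0 i1 / v 0 i2) h.
Proof.
move=> /dhomogP hf.
exists (\sum_(m <- msupp f) (f@_m *: 'X^(m i1))%:P * 'X^(m i0)).
move=> L phi v v0; rewrite /eval_at /mmap rmorph_sum mulr_sumr /=.
rewrite big_seq [RHS]big_seq; apply: eq_bigr => m /hf md.
rewrite rmorphM rmorphXn /= bievalX bievalC -mul_polyC rmorphM /= map_polyC.
rewrite map_polyXn hornerM hornerC hornerXn /=.
have -> : d = (m i0 + (m i1 + m i2))%N.
  by rewrite -md /= mdegE !big_ord_recl big_ord0 addn0.
rewrite /mmap1 !big_ord_recl big_ord0 mulr1 !exprD !exprMn !exprVn.
move: (expf_neq0 (m i0) v0) (expf_neq0 (m i1) v0).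
move: (v 0 i2 ^+ m i0) (v 0 i2 ^+ m i1) => a b a0 b0.
by field; rewrite a0 b0.
Qed.

Definition affine_point (K : fieldType) (a b : K) : 'rV[K]_3 :=
  \row_i [:: a; b; 1]`_i.

Lemma affine_pointE (K : fieldType) (a b : K) :
  [/\ affine_point a b 0 i0 = a, affine_point a b 0 i1 = b
    & affine_point a b 0 i2 = 1].
Proof. by rewrite !mxE. Qed.

Lemma map_points (K L : fieldType) (phi : {rmorphism K -> L})
    (X : quasiproj K) (v : 'rV[K]_(qp_dim X).+1) :
  rat_points X v -> points X phi (map_mx phi v).
Proof.
case=> v0 veq [g gN gv]; split; first by rewrite map_mx_eq0.
  by move=> f fE; rewrite eval_at_map veq // rmorph0.
by exists g; rewrite // eval_at_map fmorph_eq0.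
Qed.

(** * An irreducible piece of a plane curve through infinitely many given points *)

Section PlaneCurve.
Variables (K : fieldType) (x y : nat -> K) (g0 : {poly {poly K}}).
Variables (Kbar : closedFieldType) (iota : {rmorphism K -> Kbar}).
Hypotheses (y_inj : injective y) (g0_neq0 : g0 != 0).
Hypothesis g0_zero : forall n, bieval idfun (x n) (y n) g0 = 0.

(** The inequation ['X_i2 * H] removes the line at infinity and the zeros of [lead_coef g]; since y
    is injective, the latter removes only finitely many of the given points. *)
Lemma plane_curve_component :
  exists (eqs neqs : seq {mpoly K[3]})
    (eqsH : forall g, g \in eqs -> homogeneous g)
    (neqsH : forall g, g \in neqs -> homogeneous g),
  let X := @Quasiproj K 2 eqs neqs eqsH neqsH in
  [/\ irreducible iota X,
      forall m, exists2 n, (m <= n)%N & rat_points X (affine_point (x n) (y n))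
    & forall v, rat_points X v -> v 0 i2 != 0 /\
        bieval idfun (v 0 i0 / v 0 i2) (v 0 i1 / v 0 i2) g0 = 0].
Proof.
have [g [gn0 gg gmin]] := minimal_equation g0_neq0 g0_zero.
have [dG [G [homG evG]]] := homogenize g.
have [dH [H [homH evH]]] := homogenize (lead_coef g)%:P.
have eqsH f : f \in [:: G] -> homogeneous f.
  by rewrite inE => /eqP->; exists dG.
have homX2H : 'X_i2 * H \is (1 + dH).-homog.
  by rewrite dhomogM // dhomogX /= mdeg1.
have neqsH f : f \in [:: 'X_i2 * H] -> homogeneous f.
  by rewrite inE => /eqP->; exists (1 + dH)%N.
exists [:: G], [:: 'X_i2 * H], eqsH, neqsH => X.
have pointsX (L : fieldType) (phi : {rmorphism K -> L}) (v : 'rV[L]_3) :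
    points X phi v <-> [/\ v 0 i2 != 0,
      bieval phi (v 0 i0 / v 0 i2) (v 0 i1 / v 0 i2) g = 0 &
      (map_poly phi (lead_coef g)).[v 0 i1 / v 0 i2] != 0].
  have ev : eval_at phi ('X_i2 * H) v = v 0 i2 * eval_at phi H v.
    by rewrite /eval_at rmorphM /= mmapX mmap1U.
  split=> [[vn0 /(_ G) eqG [f]]|[v2 gv lv]].
    rewrite inE => /eqP->; rewrite ev mulf_eq0 negb_or => /andP[v2 Hv].
    split=> //; last first.
      by move: Hv; rewrite evH // bievalC mulf_eq0 negb_or => /andP[].
    apply/eqP; have := eqG; rewrite inE eqxx evG // => /(_ isT)/eqP.
    by rewrite mulf_eq0 expf_eq0 (negbTE v2) andbF.
  split.
  - by apply: contraNneq v2 => ->; rewrite mxE.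
  - by move=> f; rewrite inE => /eqP->; rewrite evG // gv mulr0.
  exists ('X_i2 * H); rewrite ?inE // ev evH // bievalC.
  by rewrite !mulf_neq0 // expf_neq0.
(* On X the leading coefficient is nonzero, so lead_coef(g)^k f = q g forces f = 0. *)
have vanish f (L : fieldType) (phi : {rmorphism K -> L}) (v : 'rV[L]_3) :
    common_zeros x y f g -> points X phi v ->
    bieval phi (v 0 i0 / v 0 i2) (v 0 i1 / v 0 i2) f = 0.
  move=> /gmin[k [q fE]] /pointsX[v2 gv lv].
  have := congr1 (bieval phi (v 0 i0 / v 0 i2) (v 0 i1 / v 0 i2)) fE.
  rewrite -mul_polyC !rmorphM /= gv mulr0 polyC_exp rmorphXn /= bievalC => /eqP.
  by rewrite mulf_eq0 expf_eq0 (negbTE lv) andbF => /eqP.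
have inf_points m :
    exists2 n, (m <= n)%N & rat_points X (affine_point (x n) (y n)).
  have lcn0 : lead_coef g != 0 by rewrite lead_coef_eq0.
  have [m0 lc0] := eventually_nonzero y_inj lcn0.
  have [n [le_n gn _]] := gg (maxn m m0).
  move: le_n; rewrite geq_max => /andP[le_n le_n0]; exists n => //.
  apply/pointsX; have [-> -> ->] := affine_pointE (x n) (y n).
  by rewrite oner_eq0 !divr1 map_poly_id //; split=> //; apply: lc0.
split=> //; last first.
  move=> v Xv; split; first by have /pointsX[] := Xv.
  apply: vanish Xv => m; have [n [le_n gn _]] := gg m.
  by exists n.
split.
  have [n _ Xn] := inf_points 0%N.
  by exists (map_mx iota (affine_point (x n) (y n))); apply: map_points.
(* If neither closed set contains X, each has an equation that is nonzero somewhere on X. By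
   [vanish] such an equation holds at only finitely many of the given points of X, so one of these
   points lies outside both sets. *)
move=> _ _ [TA homTA ->] [TB homTB ->] cover; apply: contrapT.
move=> /not_orP[/existsNP[v /not_implyP[Xv nAv]]].
move=> /existsNP[w /not_implyP[Xw nBw]].
have {nAv}[f TAf fv] : exists2 f, TA f & eval_at iota f v <> 0.
  apply: contrapT => nex; apply: nAv; split=> // f TAf.
  by apply: contrapT => fv; apply: nex; exists f.
have {nBw}[h TBh hw] : exists2 h, TB h & eval_at iota h w <> 0.
  apply: contrapT => nex; apply: nBw; split=> // h TBh.
  by apply: contrapT => hw; apply: nex; exists h.
have [df homf] := homTA f TAf; have [dh homh] := homTB h TBh.
have [f' f'E] := dehomogenize homf; have [h' h'E] := dehomogenize homh.
have ncommon (u : 'rV[Kbar]_3) e d e' : points X iota u ->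
    (forall (L : fieldType) (phi : {rmorphism K -> L}) (v : 'rV[L]_3),
      v 0 i2 != 0 -> eval_at phi e v =
        v 0 i2 ^+ d * bieval phi (v 0 i0 / v 0 i2) (v 0 i1 / v 0 i2) e') ->
    eval_at iota e u <> 0 -> exists m, forall n, (m <= n)%N ->
      rat_points X (affine_point (x n) (y n)) ->
      eval_at idfun e (affine_point (x n) (y n)) != 0.
  move=> Xu eE eu; have [u2 _ _] := (pointsX _ _ _).1 Xu.
  apply: contrapT => nex; apply: eu; rewrite eE // (vanish e') ?mulr0 // => m.
  apply: contrapT => nex'; apply: nex; exists m => n le_n Xn; apply/eqP => en.
  have [p0 p1 p2] := affine_pointE (x n) (y n).
  apply: nex'; exists n; split=> //.
    by move: en; rewrite eE p2 ?oner_eq0 // p0 p1 !divr1 expr1n mul1r.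
  by have /pointsX[_ + _] := Xn; rewrite p0 p1 p2 !divr1.
have [m1 nf] := ncommon _ _ _ _ Xv f'E fv.
have [m2 nh] := ncommon _ _ _ _ Xw h'E hw.
have [n le_n Xn] := inf_points (maxn m1 m2).
move: le_n; rewrite geq_max => /andP[le1 le2].
have := cover _ (map_points iota Xn).
case=> -[_] => [/(_ f TAf)|/(_ h TBh)]; rewrite eval_at_map => /eqP;
  rewrite fmorph_eq0; apply/negP; [exact: nf | exact: nh].
Qed.

End PlaneCurve.

(** * Adic balls in the first coordinate and their effect on W *)

Section SeparatingNeighbourhoods.
Variables (K Kv : fieldType) (R : realType) (j : {rmorphism K -> Kv}).
Variables (absv : Kv -> R) (Kbar : closedFieldType).
Variable iota : {rmorphism K -> Kbar}.
Hypothesis absvP : is_absolute_value absv.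

Lemma absvN (a : Kv) : absv (- a) = absv a.
Proof.
have a1 : absv 1 = 1.
  have n1 : absv 1 != 0.
    by apply/eqP => /(abs_eq0 absvP)/eqP; rewrite oner_eq0.
  by apply: (mulfI n1); rewrite -(absM absvP) !mulr1.
have aN1 : absv (-1) = 1.
  apply/eqP; rewrite -sqrp_eq1 ?(abs_ge0 absvP) //.
  by rewrite expr2 -(absM absvP) mulrNN mulr1 a1.
by rewrite -mulN1r (absM absvP) aN1 mul1r.
Qed.

(** This is the unit ball |u0/u2 - c| < 1 written without division; the strict inequality already
    forces u2 to be nonzero. *)
Lemma proj_open_affine_ball (c : Kv) :
  proj_open absv
    [set u : 'rV[Kv]_3 | absv (u 0 i0 - c * u 0 i2) < absv (u 0 i2)].
Proof.
split=> [u /= hu|a u a0 /= hu|u /= hu].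
- apply: contraTneq hu => ->.
  by rewrite !mxE mulr0 subr0 ltxx.
- rewrite !mxE mulrCA -mulrBr !(absM absvP) ltr_pM2l // lt_neqAle.
  rewrite (abs_ge0 absvP) andbT eq_sym; apply: contra_neq a0.
  exact: (abs_eq0 absvP a).1.
(* Moving the coordinates by less than e changes |u0 - c u2| by at most (1 + |c|) e and |u2| by at
   most e, so e is the slack divided by 2 + |c|. *)
pose k := 2 + absv c.
have k0 : 0 < k by rewrite ltr_wpDr ?(abs_ge0 absvP).
exists ((absv (u 0 i2) - absv (u 0 i0 - c * u 0 i2)) / k).
  by rewrite divr_gt0 // subr_gt0.
set e := _ / k => y y0 hy.
have ek : e * 2 + e * absv c = absv (u 0 i2) - absv (u 0 i0 - c * u 0 i2).
  by rewrite -mulrDr divfK ?gt_eqF.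
have h2 : absv (u 0 i2) <= absv (y 0 i2) + absv (y 0 i2 - u 0 i2).
  rewrite -(absvN (y 0 i2 - _)); apply: le_trans (abs_triangle absvP _ _).
  by rewrite opprB addrC subrK.
have h0 : absv (y 0 i0 - c * y 0 i2) <= absv (u 0 i0 - c * u 0 i2)
    + (absv (y 0 i0 - u 0 i0) + absv c * absv (y 0 i2 - u 0 i2)).
  rewrite -(absM absvP) -[X in _ + (_ + X)]absvN.
  apply: le_trans (lerD (lexx _) (abs_triangle absvP _ _)).
  apply: le_trans (abs_triangle absvP _ _).
  by rewrite le_eqVlt; apply/orP; left; apply/eqP; congr absv; ring.
have := hy i0; have := hy i2.
have : absv c * absv (y 0 i2 - u 0 i2) <= absv c * e.
  by rewrite ler_wpM2l ?(abs_ge0 absvP) // ltW.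
rewrite /=; lra.
Qed.

Variables (eqs neqs : seq {mpoly K[3]}).
Hypotheses (eqsH : forall g, g \in eqs -> homogeneous g)
  (neqsH : forall g, g \in neqs -> homogeneous g).
Let X := @Quasiproj K 2 eqs neqs eqsH neqsH.

Lemma W_rat_point (v : 'rV[K]_3) :
  rat_points X v -> W j absv iota X (map_mx j v) (map_mx iota v).
Proof. by move=> Xv U [_ Uv] A [_ subA]; apply: subA; exists v. Qed.

Lemma W_affine_coordinate (c : K) (P : 'rV[Kv]_3) :
  points X j P -> absv (P 0 i0 - j c * P 0 i2) < absv (P 0 i2) ->
  (forall v, rat_points X v ->
    absv (j (v 0 i0 - c * v 0 i2)) < absv (j (v 0 i2)) ->
    v 0 i0 = c * v 0 i2) ->
  forall w, W j absv iota X P w -> w 0 i0 = iota c * w 0 i2.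
Proof.
move=> XP ballP isolated w.
pose O := [set u : 'rV[Kv]_3 | absv (u 0 i0 - j c * u 0 i2) < absv (u 0 i2)].
move=> /(_ (points X j `&` O)) Ww.
have {Ww} := Ww (conj (ex_intro2 _ _ O (proj_open_affine_ball (j c)) erefl)
  (conj XP ballP)).
pose f : {mpoly K[3]} := 'X_i0 - c *: 'X_i2.
have ev (L : fieldType) (phi : {rmorphism K -> L}) (u : 'rV[L]_3) :
    eval_at phi f u = u 0 i0 - phi c * u 0 i2.
  by rewrite /eval_at rmorphB /= mmapZ !mmapX !mmap1U.
have homf : homogeneous f.
  exists 1%N; rewrite rpredB ?dhomogZ // dhomogX /= mdeg1 //.
(* The closed set to test is the section of X by the line u0 = c u2; by isolation it contains every
   rational point of the ball. *)
move=> /(_ [set u | points X iota u /\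
  forall g, [set f] g -> eval_at iota g u = 0]).
case; last first.
  by move=> _ /(_ f erefl); rewrite ev => /eqP; rewrite subr_eq0 => /eqP.
split; first by exists [set f] => // g ->.
move=> _ [v [Xv [_ Ov]] <-]; split; first exact: map_points.
move=> g ->; rewrite ev !mxE (isolated v Xv) ?rmorphM ?subrr //.
by rewrite rmorphB rmorphM /=; move: Ov; rewrite /O /= !mxE.
Qed.

End SeparatingNeighbourhoods.

(** * Infinite images, and the Frobenius family of solutions *)

Lemma infinite_image_nat (T : Type) (A : set nat) (f : nat -> T) :
  (forall m, exists2 n, (m <= n)%N & A n) -> {in A &, injective f} ->
  infinite_set (f @` A).
Proof.
move=> unbounded injf finfA.
have /card_eqPle[_ leA] := inj_card_eq injf.
have /finite_seqP[r rE] : finite_set A := card_le_finite leA finfA.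
have [n le_n An] := unbounded (\max_(i <- r) i).+1.
have : n \in r by move: An; rewrite rE.
by move=> /(leq_bigmax_seq (F := id))/(_ isT); rewrite leqNgt le_n.
Qed.

Definition diagonal_equation (K : fieldType) (c d : K) (N : nat) :
    {poly {poly K}} := c%:P%:P * 'X^N + (d%:P * 'X^N - 1)%:P.

Lemma diagonal_equationE (K : fieldType) (c d : K) (N : nat) (a b : K) :
  bieval idfun a b (diagonal_equation c d N) = c * a ^+ N + d * b ^+ N - 1.
Proof.
rewrite /diagonal_equation rmorphD rmorphM rmorphXn /= bievalX !bievalC.
by rewrite !map_poly_id // hornerD hornerN hornerM !hornerC hornerXn addrA.
Qed.

Lemma diagonal_equation_neq0 (K : fieldType) (c d : K) (N : nat) :
  (0 < N)%N -> diagonal_equation c d N != 0.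
Proof.
move=> N0; apply: contraTneq isT => /(congr1 (bieval idfun 0 0))/eqP.
rewrite diagonal_equationE expr0n (gtn_eqF N0).
by rewrite !mulr0 addr0 sub0r rmorph0 oppr_eq0 oner_eq0.
Qed.

Section FrobeniusPoints.
Variables (F : finFieldType) (p : nat).
Hypothesis pF : p \in [pchar F].

Local Notation "x %:F" := (@FracField.tofrac {poly F} x).
Local Notation N := (p ^ 3).-1.

(** The geometric sum (p^(3n) - 1)/(p^3 - 1), chosen so that 1 + e N is a power of p. *)
Definition frobenius_exponent (n : nat) : nat := \sum_(i < n) (p ^ 3) ^ i.

Lemma prime_exp3_gt1 : (1 < p ^ 3)%N.
Proof. by rewrite -(exp1n 3) ltn_exp2r ?prime_gt1 ?(pcharf_prime pF). Qed.

Lemma frobenius_exponentE (n : nat) :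
  (frobenius_exponent n * N).+1 = (p ^ (3 * n))%N.
Proof.
rewrite mulnC -predn_exp -expnM prednK // expn_gt0.
by rewrite prime_gt0 // (pcharf_prime pF).
Qed.

Lemma frobenius_exponent_inj : injective frobenius_exponent.
Proof.
move=> m n emn; have := frobenius_exponentE m.
rewrite emn frobenius_exponentE => /eqP; have := prime_exp3_gt1 => p3_gt1.
by rewrite !expnM eqn_exp2l // => /eqP.
Qed.

(** The left side is a^(p^(3n)) + b^(p^(3n)) = (a + b)^(p^(3n)). *)
Lemma frobenius_point (n : nat) (a b : {poly F}) : a + b = 1 ->
  a * (a ^+ frobenius_exponent n) ^+ N
    + b * (b ^+ frobenius_exponent n) ^+ N = 1.
Proof.
move=> ab; rewrite -!exprM -!exprS frobenius_exponentE.
rewrite -exprDn_pchar ?ab ?expr1n //.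
have pP : p \in [pchar {poly F}] by rewrite pchar_lalg.
by rewrite (eq_pnat _ (pcharf_eq pP)) pnatX pnat_id // (pcharf_prime pF).
Qed.

Lemma frobenius_power_inj (L : {poly F}) : size L = 2 ->
  injective (fun n => (L ^+ frobenius_exponent n)%:F).
Proof.
move=> L2 m n /eqP; rewrite tofrac_eq => /eqP.
move=> /(congr1 (fun q : {poly F} => (size q).-1)).
by rewrite !size_exp L2 !mul1n => /frobenius_exponent_inj.
Qed.

End FrobeniusPoints.

(** A nonzero polynomial has absolute value q^deg >= 1: F[t] is discrete at the infinite place. *)
Lemma abs_inf_poly_lt1 (F : finFieldType) (R : realType) (a : {poly F}) :
  abs_inf R (FracField.tofrac a) < 1 -> a = 0.
Proof.
apply: contraTeq => a0; rewrite abs_inf_poly // -leNgt exprn_ege1 // ler1n.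
exact: ltnW (finNzRing_gt1 F).
Qed.

(** * Infinitely many sets W(P) on a piece of the Fermat curve *)

Theorem theorem4p2 (F : finFieldType) (R : realType)
  (Kbar : closedFieldType) (iota : {rmorphism ratfun F -> Kbar})
  (Kbar_closure : is_alg_closure iota)
  (Kv : fieldType) (j : {rmorphism ratfun F -> Kv}) (absv : Kv -> R)
  (Kv_completion : is_completion (@abs_inf F R) j absv) :
  exists V : variety iota,
    infinite_set [set W j absv iota V P | P in points V j].
Proof.
have [p _ pF] := finPcharP F.
have absvP := completion_abs Kv_completion.
pose x n : ratfun F := FracField.tofrac ('X ^+ frobenius_exponent p n).
pose y n : ratfun F := FracField.tofrac ((1 - 'X) ^+ frobenius_exponent p n).
have size_s : size (1 - 'X : {poly F}) = 2.
  by rewrite -opprB size_polyN size_XsubC.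
have x_inj : injective x by apply: frobenius_power_inj; rewrite ?size_polyX.
have y_inj : injective y by apply: frobenius_power_inj.
pose g0 := diagonal_equation (FracField.tofrac ('X : {poly F}))
  (FracField.tofrac (1 - 'X : {poly F})) (p ^ 3).-1.
have g00 : g0 != 0.
  by rewrite diagonal_equation_neq0 // ltn_predRL (prime_exp3_gt1 pF).
have xy_zero n : bieval idfun (x n) (y n) g0 = 0.
  rewrite diagonal_equationE -!tofracXn -!tofracM -tofracD.
  by rewrite frobenius_point ?tofrac1 ?subrr // addrC subrK.
have [eqs [neqs [eqsH [neqsH]]]] :=
  plane_curve_component iota y_inj g00 xy_zero.
set X := Quasiproj _ _ => -[irrX inf_points X_fermat].
exists (Variety irrX).
pose A n := rat_points X (affine_point (x n) (y n)).
pose f n := W j absv iota X (map_mx j (affine_point (x n) (y n))).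
(* The affine X-coordinate of v is a polynomial by the descent, as is [x n]; lying at distance less
   than 1, they coincide. *)
have isolated n (v : 'rV[ratfun F]_3) : rat_points X v ->
    absv (j (v 0 i0 - x n * v 0 i2)) < absv (j (v 0 i2)) ->
    v 0 i0 = x n * v 0 i2.
  move=> /X_fermat[v2]; rewrite diagonal_equationE => /eqP; rewrite subr_eq0.
  move=> /eqP/(fermat_point_integral pF)[a va].
  have -> : v 0 i0 = FracField.tofrac a * v 0 i2 by rewrite -va divfK.
  rewrite -mulrBl -tofracB rmorphM (absM absvP) (completion_ext Kv_completion).
  have v2_gt0 : 0 < absv (j (v 0 i2)).
    rewrite lt_neqAle (abs_ge0 absvP) andbT eq_sym; apply: contra_neq v2.
    by move=> /(abs_eq0 absvP)/eqP; rewrite fmorph_eq0 => /eqP.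
  rewrite -[ltRHS]mul1r ltr_pM2r // => /abs_inf_poly_lt1/eqP.
  by rewrite subr_eq0 => /eqP->.
apply: (@sub_infinite_set _ (f @` A)).
  by move=> _ [n An <-]; exists (map_mx j (affine_point (x n) (y n)));
    first exact: map_points.
apply: infinite_image_nat => // m n /set_mem Am /set_mem An fmn.
have [m0 _ m2] := affine_pointE (x m) (y m).
have [n0 _ n2] := affine_pointE (x n) (y n).
(* If the sets at indices m and n agree, the m-th point lies in W of the n-th, whose elements all
   have X-coordinate [x n]; so x m = x n. *)
have := W_rat_point (j := j) (absv := absv) (iota := iota) Am.
rewrite -/(f m) fmn.
move=> /(W_affine_coordinate absvP (c := x n) (map_points j An)).
rewrite !mxE /= !rmorph1 !mulr1 => sep; apply: x_inj; apply: (fmorph_inj iota).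
apply: sep; last exact: isolated.
have absv0 : absv 0 = 0 by apply/(abs_eq0 absvP).
rewrite subrr absv0 lt_neqAle (abs_ge0 absvP) andbT eq_sym.
by apply/eqP => /(abs_eq0 absvP)/eqP; rewrite oner_eq0.
Qed.
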